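(* Let $z_1,\dots,z_r\in\Lambda_\phi$ and let $\kappa(t)=\det\big(\omega_{z_j}^{(i-1)}(t)\big)_{1\le i,j\le r}\in\mathbb{T}$ be the Moore determinant of $\omega_{z_1},\dots,\omega_{z_r}$. Write $[\kappa(t)]_{\mathfrak{f}}=\sum_{j=0}^{n-1}K_jt^j$ with $K_j\in\mathbb{C}_\infty$, and for each $i$ let $C_{z_i,n-1}$ be the coefficient of $t^{n-1}$ in $[\omega_{z_i}(t)]_{\mathfrak{f}}$. Then: (1) $\sum_{j=0}^{n-1}K_jt^j=\mathcal{M}\Big(\operatorname{O}^{(r+1)}_{\mathfrak{f}}(X_1,\dots,X_r,t)\diamond_\phi\big(C_{z_1,n-1}\otimes\cdots\otimes C_{z_r,n-1}\big)\Big)$; (2) $K_{n-1}=\operatorname{Weil}_{\mathfrak{f}}(C_{z_1,n-1},\dots,C_{z_r,n-1})$.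
   Context: Let $\mathbb{F}_q$ be the finite field with $q$ elements and $\theta$ transcendental over $\mathbb{F}_q$; let $K_\infty=\mathbb{F}_q((1/\theta))$ with absolute value normalized by $|\theta|=q$, and $\mathbb{C}_\infty$ the completion of an algebraic closure of $K_\infty$. Let $\phi$ be a Drinfeld $\mathbb{F}_q[x]$-module of rank $r\ge1$ with $\phi_x=\theta+g_1\tau+\cdots+g_r\tau^r$, where $g_i$ lie in a field $K$ with $\mathbb{F}_q(\theta)\subseteq K\subseteq\mathbb{C}_\infty$, $g_r\neq0$, and $\tau$ is the $q$-power Frobenius; $\phi_a$ denotes the image of $a\in\mathbb{F}_q[x]$. Let $\exp_\phi(\mu)=\sum_{i\ge0}\mu^{q^i}/D_i$ be the exponential of $\phi$ (the $\mathbb{F}_q$-linear entire function with $\phi_a(\exp_\phi\mu)=\exp_\phi(a(\theta)\mu)$), and $\Lambda_\phi=\ker\exp_\phi$ its lattice. For $z$, the Anderson generating function is $\omega_z(t)=\sum_{k\ge0}\exp_\phi(z/\theta^{k+1})t^k$. The Tate algebra is $\mathbb{T}=\{\sum_{i\ge0}c_it^i\in\mathbb{C}_\infty[[t]]: |c_i|\to0\}$; for $\omega=\sum c_it^i\in\mathbb{T}$ and $k\ge0$, $\omega^{(k)}=\sum c_i^{q^k}t^i$. Let $\mathfrak{f}(t)=a_nt^n+\cdots+a_0\in\mathbb{F}_q[t]$ be monic of degree $n\ge1$. The quotient map $\mathbb{C}_\infty[t]\to\mathbb{C}_\infty[t]/\mathfrak{f}\mathbb{C}_\infty[t]$ extends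 uniquely to a continuous homomorphism $\operatorname{ev}_{\mathfrak{f}}:\mathbb{T}\to\mathbb{C}_\infty[t]/\mathfrak{f}\mathbb{C}_\infty[t]$ (kernel $\mathfrak{f}\mathbb{T}$); the $\mathfrak{f}$-remainder $[\omega]_{\mathfrak{f}}$ of $\omega\in\mathbb{T}$ is the unique polynomial of degree $<n$ representing $\operatorname{ev}_{\mathfrak{f}}(\omega)$. Weil operators: let $\operatorname{D}_{\mathfrak{f}}$ be the $\mathbb{F}_q$-linear map on polynomials of degree $<n$ in a variable $X$ with $\operatorname{D}_{\mathfrak{f}}(X^i)=\sum_{j=0}^{n-i-1}a_{i+j+1}X^j$ for $0\le i\le n-1$. Put $\operatorname{O}^{(1)}_{\mathfrak{f}}=1$, $\operatorname{O}^{(2)}_{\mathfrak{f}}(X_1,X_2)=\sum_{k=0}^{n-1}\operatorname{D}_{\mathfrak{f}}(X_1^k)X_2^k$, and for $s>2$ let $\operatorname{O}^{(s)}_{\mathfrak{f}}(X_1,\dots,X_s)$ be the unique polynomial with all $X_i$-degrees $<n$ that is congruent to $\prod_{j=1}^{s-1}\operatorname{O}^{(2)}_{\mathfrak{f}}(X_j,X_s)$ modulo $\mathfrak{f}(X_s)$. Action and Moore determinant: for $F=\sum_{\mathbf{a}}F_{\mathbf{a}}(t)X_1^{a_1}\cdots X_r^{a_r}$ with $F_{\mathbf{a}}\in\mathbb{F}_q[t]$ and $\mu_1,\dots,\mu_r\in\mathbb{C}_\infty$, set $F\diamond_\phi(\mu_1\otimes\cdots\otimes\mu_r)=\sum_{\mathbf{a}}F_{\mathbf{a}}(t)\,\phi_{x^{a_1}}(\mu_1)\otimes\cdots\otimes\phi_{x^{a_r}}(\mu_r)$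 (tensors over $\mathbb{F}_q$), and $\mathcal{M}$ is the $\mathbb{F}_q[t]$-linear map with $\mathcal{M}\big(g(t)\,\nu_1\otimes\cdots\otimes\nu_r\big)=g(t)\det(\nu_j^{q^{i-1}})_{1\le i,j\le r}$ for $\nu_j\in\mathbb{C}_\infty$, $g\in\mathbb{F}_q[t]$. The Weil pairing is $\operatorname{Weil}_{\mathfrak{f}}(\mu_1,\dots,\mu_r)=\mathcal{M}\big(\operatorname{O}^{(r)}_{\mathfrak{f}}(X_1,\dots,X_r)\diamond_\phi(\mu_1\otimes\cdots\otimes\mu_r)\big)$. *)

(* Defs.v *)
From HB Require Import structures.
From mathcomp Require Import all_boot all_order all_algebra.
From mathcomp Require Import fingroup pgroup abelian finfield.
From mathcomp Require Import mpoly.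
From mathcomp Require Import boolp classical_sets reals topology sequences.
From mathcomp Require Import normedtype.

Set Implicit Arguments.
Unset Strict Implicit.
Unset Printing Implicit Defensive.
Import Order.TTheory GRing.Theory Num.Theory.
Import numFieldNormedType.Exports.
Local Open Scope classical_set_scope.
Local Open Scope ring_scope.

Record nonarch (R : realType) (C : fieldType) := NonArch {
  nabs :> C -> R;
  nabs_ge0 : forall x, 0 <= nabs x;
  nabs_eq0 : forall x, (nabs x == 0) = (x == 0);
  nabsM : forall x y, nabs (x * y) = nabs x * nabs y;
  nabsD : forall x y, nabs (x + y) <= Num.max (nabs x) (nabs y)
}.

Definition vnull (R : realType) (C : fieldType) (v : nonarch R C)
    (u : nat -> C) : Prop :=
  v (u k) @[k --> \oo] --> (0 : R).

Definition vcvg (R : realType) (C : fieldType) (v : nonarch R C)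
    (u : nat -> C) (l : C) : Prop :=
  vnull v (fun k => u k - l).

Definition vcauchy (R : realType) (C : fieldType) (v : nonarch R C)
    (u : nat -> C) : Prop :=
  forall eps : R, 0 < eps ->
    exists N, forall i j, (N <= i)%N -> (N <= j)%N -> v (u i - u j) < eps.

Section NonArchTheory.
Context (R : realType) (C : fieldType) (v : nonarch R C).

Lemma nabs0 : v 0 = 0.
Proof. by apply/eqP; rewrite nabs_eq0. Qed.

Lemma nabs1 : v 1 = 1.
Proof.
have v1 : v 1 != 0 by rewrite nabs_eq0 oner_eq0.
by apply: (mulIf v1); rewrite -nabsM !mul1r.
Qed.

Lemma nabsX x k : v (x ^+ k) = v x ^+ k.
Proof.
by elim: k => [|k IH]; rewrite ?expr0 ?nabs1 // !exprS nabsM IH.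
Qed.

Lemma nabsN x : v (- x) = v x.
Proof.
have h : v (-1) ^+ 2 = 1 by rewrite -nabsX sqrrN expr1n nabs1.
have h1 : v (-1) = 1.
  have := nabs_ge0 v (-1); move/eqP: h.
  by rewrite sqrf_eq1 => /orP[/eqP->//|/eqP->]; rewrite ler0N1.
by rewrite -mulN1r nabsM h1 mul1r.
Qed.

Lemma nabs_sum_le (e : R) n (u : nat -> C) : 0 <= e ->
  (forall i, (i < n)%N -> v (u i) <= e) -> v (\sum_(i < n) u i) <= e.
Proof.
move=> e0; elim: n => [|n IH] h; first by rewrite big_ord0 nabs0.
rewrite big_ord_recr /=; apply: (le_trans (nabsD v _ _)).
by rewrite ge_max h // IH // => i ilt; apply: h; apply: leqW.
Qed.

Lemma nabs_sum_lt (e : R) n (u : nat -> C) : 0 < e ->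
  (forall i, (i < n)%N -> v (u i) < e) -> v (\sum_(i < n) u i) < e.
Proof.
move=> e0; elim: n => [|n IH] h; first by rewrite big_ord0 nabs0.
rewrite big_ord_recr /=; apply: (le_lt_trans (nabsD v _ _)).
by rewrite gt_max h // IH // => i ilt; apply: h; apply: leqW.
Qed.

Lemma vnullP (u : nat -> C) :
  vnull v u <-> forall e : R, 0 < e ->
                exists N, forall i, (N <= i)%N -> v (u i) < e.
Proof.
split=> [/cvgrPdist_lt h e /h [N _ hN]|h].
  exists N => i /= Ni; have := hN i Ni.
  by rewrite /= sub0r normrN ger0_norm ?nabs_ge0.
apply/cvgrPdist_lt => e /h [N hN]; exists N => //= i /= Ni.
by rewrite sub0r normrN ger0_norm ?nabs_ge0 // hN.
Qed.

Lemma vnull_bounded (u : nat -> C) : vnull v u ->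
  exists2 B : R, 0 < B & forall i, v (u i) <= B.
Proof.
move=> /vnullP /(_ 1 ltr01) [N hN].
exists (1 + \sum_(i < N) v (u i)).
  by rewrite ltr_pwDl // sumr_ge0 // => i _; apply: nabs_ge0.
move=> i; have [Ni|iN] := leqP N i.
  apply: (le_trans (ltW (hN _ Ni))).
  by rewrite lerDl sumr_ge0 // => j _; apply: nabs_ge0.
rewrite (bigD1 (Ordinal iN)) //= addrCA lerDl addr_ge0 // sumr_ge0 // => j _.
exact: nabs_ge0.
Qed.

End NonArchTheory.

Section Cinfty.
Context (R : realType) (F : finFieldType).

Section Subfields.
Context (C : fieldType) (iota : {rmorphism F -> C}) (theta : C).
Context (v : nonarch R C).

(* x = theta ^ N * (c_0 + c_1 / theta + c_2 / theta ^ 2 + ...) *)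
Definition in_Kinfty (x : C) : Prop :=
  exists (N : nat) (c : nat -> F),
    vcvg v (fun m => theta ^+ N * \sum_(i < m) iota (c i) / theta ^+ i) x.

Definition algebraic_over_Kinfty (x : C) : Prop :=
  exists p : {poly C}, [/\ p != 0, forall i, in_Kinfty p`_i & root p x].

End Subfields.

(* A completion of an algebraic closure of K_oo = F_q((1/theta)): a complete
   valued field in which the elements algebraic over K_oo form an algebraically
   closed, dense subfield.  The absolute value of iota c is automatically 1 for
   c != 0, and theta is automatically transcendental over F_q, as
   |theta| = q > 1. *)
Record cinfty := Cinfty {
  cinf_car :> fieldType;
  cinf_iota : {rmorphism F -> cinf_car};
  cinf_theta : cinf_car;
  cinf_abs : nonarch R cinf_car;
  cinf_abs_theta : cinf_abs cinf_theta = #|F|%:R;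
  cinf_complete : forall u, vcauchy cinf_abs u -> exists l, vcvg cinf_abs u l;
  cinf_alg_closed : forall p : {poly cinf_car},
    (forall i, algebraic_over_Kinfty cinf_iota cinf_theta cinf_abs p`_i) ->
    (1 < size p)%N ->
    exists2 x, algebraic_over_Kinfty cinf_iota cinf_theta cinf_abs x & root p x;
  cinf_dense : forall (x : cinf_car) (eps : R), 0 < eps ->
    exists2 y, algebraic_over_Kinfty cinf_iota cinf_theta cinf_abs y
             & cinf_abs (x - y) < eps
}.

End Cinfty.

Arguments cinf_iota {R F} _.
Arguments cinf_theta {R F} _.
Arguments cinf_abs {R F} _.

Record tate (R : realType) (C : fieldType) (v : nonarch R C) := Tate {
  tcoef : nat -> C;
  tcoef_null : vnull v tcoef
}.

Section TateRing.
Context (R : realType) (C : fieldType) (v : nonarch R C).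
Local Notation T := (tate v).

Lemma tateP (a b : T) : (forall i, tcoef a i = tcoef b i) -> a = b.
Proof.
case: a b => [a ha] [b hb] /= /funext eab; rewrite eab in ha *.
by congr Tate; apply: Prop_irrelevance.
Qed.

HB.instance Definition _ := gen_eqMixin T.
HB.instance Definition _ := gen_choiceMixin T.

Fact tate0_null : vnull v (fun=> 0).
Proof. by apply/vnullP => e e0; exists 0%N => i _; rewrite nabs0. Qed.

Fact tate1_null : vnull v (fun i => (i == 0%N)%:R).
Proof. by apply/vnullP => e e0; exists 1%N => -[//|i] _; rewrite nabs0. Qed.

Fact tateN_null (a : T) : vnull v (fun i => - tcoef a i).
Proof.
apply/vnullP => e e0; have /vnullP/(_ e e0)[N hN] := tcoef_null a.
by exists N => i /hN; rewrite nabsN.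
Qed.

Fact tateD_null (a b : T) : vnull v (fun i => tcoef a i + tcoef b i).
Proof.
apply/vnullP => e e0; have /vnullP/(_ e e0)[N hN] := tcoef_null a.
have /vnullP/(_ e e0)[M hM] := tcoef_null b.
exists (maxn N M) => i; rewrite geq_max => /andP[/hN ha /hM hb].
by apply: (le_lt_trans (nabsD v _ _)); rewrite gt_max ha hb.
Qed.

Fact tateM_null (a b : T) :
  vnull v (fun k => \sum_(i < k.+1) tcoef a i * tcoef b (k - i)).
Proof.
have [A A0 hA] := vnull_bounded (tcoef_null a).
have [B B0 hB] := vnull_bounded (tcoef_null b).
apply/vnullP => e e0.
have /vnullP/(_ (e / B))[|N hN] := tcoef_null a; first exact: divr_gt0.
have /vnullP/(_ (e / A))[|M hM] := tcoef_null b; first exact: divr_gt0.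
exists (N + M)%N => k NMk.
apply: (nabs_sum_lt (u := fun i => tcoef a i * tcoef b (k - i))) => // i _.
rewrite nabsM; have [Ni|iN] := leqP N i.
  apply: (@le_lt_trans _ _ (v (tcoef a i) * B)).
    by apply: ler_wpM2l; rewrite ?nabs_ge0.
  by rewrite -ltr_pdivlMr // hN.
apply: (@le_lt_trans _ _ (A * v (tcoef b (k - i)))).
  by apply: ler_wpM2r; rewrite ?nabs_ge0.
rewrite mulrC -ltr_pdivlMr // hM // leq_subRL.
  by apply: leq_trans NMk; rewrite leq_add2r ltnW.
by apply: leq_trans NMk; apply: leq_trans (ltnW iN) (leq_addr _ _).
Qed.

Definition tate0 : T := Tate tate0_null.
Definition tate1 : T := Tate tate1_null.
Definition tate_opp a : T := Tate (tateN_null a).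
Definition tate_add a b : T := Tate (tateD_null a b).
Definition tate_mul a b : T := Tate (tateM_null a b).

Fact tate_addA : associative tate_add.
Proof. by move=> a b c; apply: tateP => i /=; rewrite addrA. Qed.
Fact tate_addC : commutative tate_add.
Proof. by move=> a b; apply: tateP => i /=; rewrite addrC. Qed.
Fact tate_add0 : left_id tate0 tate_add.
Proof. by move=> a; apply: tateP => i /=; rewrite add0r. Qed.
Fact tate_addN : left_inverse tate0 tate_opp tate_add.
Proof. by move=> a; apply: tateP => i /=; rewrite addNr. Qed.

HB.instance Definition _ := GRing.isZmodule.Build T
  tate_addA tate_addC tate_add0 tate_addN.

Lemma tate_mulE (a b : T) k m : (k < m)%N ->
  tcoef (tate_mul a b) k =
    ((\poly_(i < m) tcoef a i) * (\poly_(i < m) tcoef b i))`_k.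
Proof.
move=> km; rewrite coefM; apply: eq_bigr => i _.
rewrite !coef_poly (leq_trans (ltn_ord i) km).
by rewrite (leq_ltn_trans (leq_subr _ _) km).
Qed.

Fact tate_mulC : commutative tate_mul.
Proof.
by move=> a b; apply: tateP => k; rewrite !(tate_mulE _ _ (ltnSn k)) mulrC.
Qed.

Fact tate_mulA : associative tate_mul.
Proof.
move=> a b c; apply: tateP => k.
pose P (d : T) := \poly_(i < k.+1) tcoef d i.
transitivity ((P a * (P b * P c))`_k).
  rewrite coefM; apply: eq_bigr => i _; rewrite coef_poly ltn_ord.
  by rewrite -tate_mulE // ltnS leq_subr.
rewrite mulrA coefM; apply: eq_bigr => i _.
by rewrite -tate_mulE // coef_poly ltnS leq_subr.
Qed.

Fact tate_mul1 : left_id tate1 tate_mul.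
Proof.
move=> a; apply: tateP => k /=; rewrite big_ord_recl /= mul1r subn0.
by rewrite big1 ?addr0 // => i _; rewrite mul0r.
Qed.

Fact tate_mulDl : left_distributive tate_mul tate_add.
Proof.
move=> a b c; apply: tateP => k /=; rewrite -big_split /=.
by apply: eq_bigr => i _; rewrite mulrDl.
Qed.

Fact tate1_neq0 : tate1 != 0.
Proof.
apply/eqP => /(congr1 (fun a : T => tcoef a 0)) /= /eqP.
by rewrite oner_eq0.
Qed.

HB.instance Definition _ := GRing.Zmodule_isComNzRing.Build T
  tate_mulA tate_mulC tate_mul1 tate_mulDl tate1_neq0.

Fact twist_null (F : finFieldType) (k : nat) (a : T) :
  vnull v (fun i => tcoef a i ^+ (#|F| ^ k)).
Proof.
have q0 : (0 < #|F| ^ k)%N.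
  by rewrite expn_gt0; apply/orP; left; apply/card_gt0P; exists 0.
apply/vnullP => e e0.
have /vnullP/(_ (Num.min e 1))[|N hN] := tcoef_null a.
  by rewrite lt_min e0 ltr01.
exists N => i /hN; rewrite lt_min => /andP[ae a1]; rewrite nabsX.
rewrite -(prednK q0) exprS; apply: le_lt_trans ae.
by rewrite ler_piMr ?nabs_ge0 // exprn_ile1 ?nabs_ge0 // ltW.
Qed.

(* omega^(k), for q = #|F| *)
Definition twist (F : finFieldType) (k : nat) (a : T) : T :=
  Tate (twist_null F k a).

End TateRing.

(* For f monic of degree >= 1, {poly %/ f} is C[t]/fC[t], its elements being
   stored as reduced representatives: (ev w : {poly C}) is the f-remainder of w.
   The topologies are those of the Gauss norm on the Tate algebra and of the
   sup norm on the coefficients of the reduced representative (any two norms on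
   this finite-dimensional vector space over a complete field are equivalent). *)
Record is_evaluation (R : realType) (C : fieldType) (v : nonarch R C)
    (f : {poly C}) (ev : {rmorphism tate v -> {poly %/ f}}) : Prop := {
  ev_poly : forall (w : tate v) (p : {poly C}),
    (forall i, tcoef w i = p`_i) -> ev w = in_qpoly f p;
  ev_continuous : forall (w : tate v) (eps : R), 0 < eps ->
    exists2 delta : R, 0 < delta &
      forall w' : tate v, (forall i, v (tcoef w' i - tcoef w i) <= delta) ->
      forall j, v ((ev w' : {poly C})`_j - (ev w : {poly C})`_j) <= eps
}.

Section Drinfeld.
Context (R : realType) (F : finFieldType) (Ci : cinfty R F).
Local Notation q := #|F|.
Local Notation iota := (cinf_iota Ci).
Local Notation theta := (cinf_theta Ci).

(* Only the values g_1, ..., g_r of dri_coef are used. *)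
Record drinfeld (K : divringClosed Ci) (r : nat) := Drinfeld {
  dri_coef : nat -> Ci;
  dri_coefK : forall i, (1 <= i <= r)%N -> dri_coef i \in K;
  dri_lead : dri_coef r != 0
}.

Context (K : divringClosed Ci) (r : nat) (phi : drinfeld K r).

Definition phi_x (mu : Ci) : Ci :=
  theta * mu + \sum_(1 <= i < r.+1) dri_coef phi i * mu ^+ (q ^ i).

(* phi_a, as an operator on C_oo: a |-> phi_a is the F_q-algebra morphism
   sending x to phi_x. *)
Definition phi_act (a : {poly F}) (mu : Ci) : Ci :=
  \sum_(i < size a) iota a`_i * iter i phi_x mu.

(* exp_coef i is 1 / D_i; this coefficient may vanish. *)
Record exponential := Exponential {
  exp_coef : nat -> Ci;
  exp_fun :> Ci -> Ci;
  exp_coef0 : exp_coef 0 = 1;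
  exp_series : forall mu, vcvg (cinf_abs Ci)
    (fun m => \sum_(i < m) exp_coef i * mu ^+ (q ^ i)) (exp_fun mu);
  exp_functional : forall (a : {poly F}) (mu : Ci),
    phi_act a (exp_fun mu) = exp_fun ((map_poly iota a).[theta] * mu)
}.

Definition in_lattice (e : exponential) (z : Ci) : Prop := e z = 0.

Fact anderson_null (e : exponential) (z : Ci) :
  vnull (cinf_abs Ci) (fun k => e (z / theta ^+ k.+1)).
Proof.
pose v := cinf_abs Ci.
have q1 : 1 < q%:R :> R by rewrite ltr1n card_finNzRing_gt1.
have q0 : 0 < q%:R :> R by apply: lt_trans q1.
have ec_null : vnull v (exp_coef e).
  apply/vnullP => eps eps0.
  have /vnullP/(_ eps eps0)[N hN] := exp_series e 1.
  exists N => i Ni; have hi := hN i Ni; have hi1 := hN i.+1 (leqW Ni).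
  rewrite big_ord_recr /= expr1n mulr1 in hi1.
  set s := \sum_(j < i) _ in hi hi1.
  have -> : exp_coef e i = s + exp_coef e i - e 1 + - (s - e 1).
    by rewrite opprB addrA subrK addrAC subrr add0r.
  by apply: (le_lt_trans (nabsD _ _ _)); rewrite gt_max nabsN hi hi1.
have [B B0 hB] := vnull_bounded ec_null.
have small mu eps : 0 < eps -> v mu <= 1 -> B * v mu < eps -> v (e mu) < eps.
  move=> eps0 mu1 Bmu; have /vnullP/(_ eps eps0)[N /(_ N (leqnn N))] := exp_series e mu.
  set s := \sum_(j < N) _ => hs.
  have -> : e mu = s + - (s - e mu) by rewrite opprB addrC subrK.
  apply: (le_lt_trans (nabsD _ _ _)); rewrite gt_max nabsN hs andbT.
  apply: (@nabs_sum_lt _ _ _ _ _ (fun i => exp_coef e i * mu ^+ (q ^ i))) => // i _.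
  rewrite nabsM nabsX; apply: le_lt_trans Bmu.
  apply: ler_pM; rewrite ?exprn_ge0 ?nabs_ge0 //.
  have qi0 : (0 < q ^ i)%N by rewrite expn_gt0 ltnW ?card_finNzRing_gt1.
  by rewrite -(prednK qi0) exprS ler_piMr ?nabs_ge0 // exprn_ile1 ?nabs_ge0.
apply/vnullP => eps eps0.
have muk k : v (z / theta ^+ k.+1) = v z / q%:R ^+ k.+1.
  have th0 : theta ^+ k.+1 != 0.
    by rewrite expf_neq0 // -(nabs_eq0 v) cinf_abs_theta gt_eqF.
  have vt : v (theta ^+ k.+1) = q%:R ^+ k.+1 by rewrite nabsX cinf_abs_theta.
  have := nabsM v (z / theta ^+ k.+1) (theta ^+ k.+1).
  rewrite divfK // vt => ->; rewrite mulfK // expf_neq0 //.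
  by rewrite gt_eqF.
pose delta := Num.min 1 (eps / B / 2%:R).
have d0 : 0 < delta by rewrite lt_min ltr01 !divr_gt0.
have [N hN] : exists N, forall k, (N <= k)%N -> v (z / theta ^+ k.+1) <= delta.
  have [N hN] : exists N : nat, v z / delta < N%:R.
    exists (Num.bound (v z / delta)); apply: archi_boundP.
    by rewrite divr_ge0 ?nabs_ge0 ?ltW.
  exists N => k Nk; rewrite muk ler_pdivrMr ?exprn_gt0 //.
  rewrite mulrC -ler_pdivrMr //; apply: (le_trans (ltW hN)).
  rewrite -natrX ler_nat; apply: (leq_trans Nk); apply: ltnW.
  by apply: ltnW; apply: ltn_expl; apply: card_finNzRing_gt1.
exists N => k /hN; rewrite le_min => /andP[m1 m2]; apply: small => //.
rewrite mulrC -ltr_pdivlMr //; apply: (le_lt_trans m2).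
by rewrite ltr_pdivrMr // ltr_pMr ?divr_gt0 // ltr1n.
Qed.

Definition anderson (e : exponential) (z : Ci) : tate (cinf_abs Ci) :=
  Tate (anderson_null e z).

(* The formal sum [:: (g_1, nu_1); ...; (g_l, nu_l)] represents the element of
   F_q[t] (x) C_oo (x) ... (x) C_oo (tensor products over F_q) that is the sum
   of the g_k (x) nu_k(0) (x) ... (x) nu_k(r-1).  By moore_multilinear below,
   moore only depends on the tensor represented. *)
Definition tensor := seq ({poly F} * ('I_r -> Ci)).

Definition diamond (G : {mpoly {poly F}[r]}) (mu : 'I_r -> Ci) : tensor :=
  [seq (G@_m, fun j => phi_act 'X^(m j) (mu j)) | m <- msupp G].

Definition moore (x : tensor) : {poly Ci} :=
  \sum_(y <- x)
    map_poly iota y.1 * (\det (\matrix_(i < r, j < r) y.2 j ^+ (q ^ i)))%:P.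

Lemma frobenius_linear k (c : F) (a b : Ci) :
  (iota c * a + b) ^+ (q ^ k) = iota c * a ^+ (q ^ k) + b ^+ (q ^ k).
Proof.
have [p p_pr pF] := finPcharP F.
have q_nat : (p.-nat (#|F| ^ k))%N.
  have := abelem_pgroup (fin_ring_pchar_abelem pF).
  by rewrite /pgroup cardsT pnatX => ->.
rewrite exprDn_pchar; last first.
  by rewrite (eq_pnat _ (pcharf_eq (rmorph_pchar iota pF))).
congr (_ + _); rewrite exprMn_comm; last exact: mulrC.
congr (_ * _); rewrite -rmorphXn; congr (iota _).
by elim: k {q_nat} => [|k IH]; rewrite ?expr1 // expnS exprM expf_card.
Qed.

Lemma moore_multilinear (g : {poly F}) (nu : 'I_r -> Ci) (j : 'I_r) (c : F)
    (a b : Ci) :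
  let put x := fun i => if i == j then x else nu i in
  moore [:: (g, put (iota c * a + b))]
  = moore [:: (c *: g, put a); (g, put b)].
Proof.
move=> put; rewrite /moore !big_cons !big_nil /= !addr0.
pose M x := \matrix_(i < r, l < r) put x l ^+ (q ^ i).
rewrite -/(M a) -/(M b) -/(M (iota c * a + b)).
have -> : \det (M (iota c * a + b)) = iota c * \det (M a) + \det (M b).
  rewrite -det_tr -(det_tr (M a)) -(det_tr (M b)) -[X in _ = _ + X]mul1r.
  apply: (@determinant_multilinear _ _ _ _ _ j).
  - by apply/rowP => i; rewrite !mxE /put eqxx mul1r frobenius_linear.
  - by apply/matrixP => i l; rewrite !mxE /put eq_sym (negPf (neq_lift _ _)).
  - by apply/matrixP => i l; rewrite !mxE /put eq_sym (negPf (neq_lift _ _)).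
rewrite map_polyZ /= -mul_polyC polyCD polyCM mulrDr; congr (_ + _).
by rewrite mulrCA mulrA.
Qed.

End Drinfeld.

Arguments moore {R F Ci r} x.

(* The variables X_1, ..., X_s are numbered from 0: 'X_0, ..., 'X_(s-1). *)

Section WeilOperators.
Context (F : fieldType) (f : {poly F}).
Local Notation n := (size f).-1.

Definition weilD (p : {poly F}) : {poly F} :=
  \sum_(i < n) p`_i *: \poly_(j < n - i) f`_(i + j).+1.

Definition weilO2 (A : comAlgType F) (X Y : A) : A :=
  \sum_(k < n) horner_alg X (weilD 'X^k) * Y ^+ k.

Definition is_weilO (s : nat) : {mpoly F[s]} -> Prop :=
  match s with
  | 0 => fun _ => False
  | 1 => fun O => O = 1
  | 2 => fun O => O = weilO2 'X_ord0 'X_ord_max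
  | s'.+3 => fun O =>
      (forall m, m \in msupp O -> forall i, (m i < n)%N) /\
      exists H, \prod_(j < s'.+2) weilO2 'X_(lift ord_max j) 'X_ord_max
                = O + H * horner_alg 'X_ord_max f
  end.

(* O(X_1, ..., X_r) seen with constant coefficients in F_q[t] *)
Definition const_t (r : nat) (O : {mpoly F[r]}) : {mpoly {poly F}[r]} :=
  map_mpoly polyC O.

(* O(X_1, ..., X_r, t) *)
Definition last_t (r : nat) (O : {mpoly F[r.+1]}) : {mpoly {poly F}[r]} :=
  mmap (fun c => (c%:P)%:MP)
       (fun i => if unlift ord_max i is Some j then 'X_j else 'X%:MP) O.

End WeilOperators.

(* Here O is the operator O^(r); the value is a constant polynomial, since O has
   constant coefficients. *)
Definition weil_pairing (R : realType) (F : finFieldType) (Ci : cinfty R F)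
    (K : divringClosed Ci) (r : nat) (phi : drinfeld K r) (O : {mpoly F[r]})
    (mu : 'I_r -> Ci) : {poly Ci} :=
  moore (diamond phi (const_t O) mu).

(* Main.v *)
(* Since the z_j are periods, phi_x applied coefficientwise to omega_{z_j} is
   multiplication by t.  Modulo f this turns into a recurrence on the
   coefficients c_k of the remainder of omega_{z_j}: with C = c_{n-1}, one gets
   c_k = phi_{D(X^k)}(C) and phi_f(C) = 0.  Twisting commutes with ev because f
   has coefficients in F_q (checked on polynomials, then by continuity).

   For sequences s_j, let N_s be the linear functional on F_q[X_1, ..., X_r, t]
   sending X^a t^b to t^b prod_j s_j(a_j).  By the Leibniz formula, the Moore
   map applied to P diamond (C_1 (x) ... (x) C_r) is the signed sum over the
   permutations sigma of N_s(P), where s_j(a) = phi_{x^a}(C_j)^{q^sigma(j)}.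
   N_s turns products of polynomials in (X_j, t) into products, multiplies by
   f(t) on multiples of f(t), and kills multiples of f(X_j) as phi_f(C_j) = 0.
   Applied to prod_j O2(X_j, t) this gives (1).  For (2), the identity
   (X - Y) O2(X, Y) = f(X) - f(Y) shows that, modulo f(X_r) and f(t),
   prod_{j <= r} O2(X_j, t) is O2(X_r, t) prod_{j < r} O2(X_j, X_r), whose
   coefficient at t^{n-1} is O^(r), f being monic. *)
Require Import Defs.
From HB Require Import structures.
From mathcomp Require Import all_boot all_order all_algebra.
From mathcomp Require Import fingroup perm qpoly ring.
From mathcomp Require Import ssrcomplements mpoly.
From mathcomp Require Import reals.

Set Implicit Arguments.
Unset Strict Implicit.
Unset Printing Implicit Defensive.
Import Order.TTheory GRing.Theory Num.Theory.
Local Open Scope ring_scope.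

Section MonomialFunctional.
Context (n : nat) (A S : comNzRingType) (g : {rmorphism A -> S}).
Implicit Types (h : 'X_{1..n} -> S) (P Q : {mpoly A[n]}).

Definition mlin h P : S := \sum_(m <- msupp P) g P@_m * h m.

Lemma mlinE h P k : (msize P <= k)%N ->
  mlin h P = \sum_(m : 'X_{1..n < k}) g P@_m * h m.
Proof.
move=> le_Pk; rewrite /mlin (big_mksub 'X_{1..n < k}) ?msupp_uniq //=.
  by rewrite big_rmcond //= => j /memN_msupp_eq0 ->; rewrite rmorph0 mul0r.
by move=> x /msize_mdeg_lt /leq_trans; apply.
Qed.

Fact mlin_is_additive h : zmod_morphism (mlin h).
Proof.
move=> P Q; pose k := maxn (msize (P - Q)) (maxn (msize P) (msize Q)).
rewrite !(@mlinE h _ k) ?leq_max ?leqnn ?orbT // -sumrB.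
by apply: eq_bigr => m _; rewrite !raddfB mulrBl.
Qed.

HB.instance Definition _ h :=
  GRing.isZmodMorphism.Build {mpoly A[n]} S (mlin h) (mlin_is_additive h).

Lemma mlinZ h c P : mlin h (c *: P) = g c * mlin h P.
Proof.
pose k := maxn (msize (c *: P)) (msize P).
rewrite !(@mlinE h _ k) ?leq_max ?leqnn ?orbT // mulr_sumr.
by apply: eq_bigr => m _; rewrite mcoeffZ rmorphM mulrA.
Qed.

Lemma mlinX h m : mlin h 'X_[m] = h m.
Proof. by rewrite /mlin msuppX big_seq1 mcoeffX eqxx rmorph1 mul1r. Qed.

Lemma mlin_sum h (I : Type) (s : seq I) (c : I -> S) (hI : I -> 'X_{1..n} -> S) P :
  (forall m, h m = \sum_(i <- s) c i * hI i m) ->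
  mlin h P = \sum_(i <- s) c i * mlin (hI i) P.
Proof.
move=> hE; under [RHS]eq_bigr do rewrite mulr_sumr.
rewrite exchange_big; apply: eq_bigr => m _ /=.
by rewrite hE mulr_sumr; apply: eq_bigr => i _; rewrite mulrCA.
Qed.

Lemma mpoly_additive_eq (U : zmodType) (u w : {additive {mpoly A[n]} -> U}) :
  (forall c m, u (c *: 'X_[m]) = w (c *: 'X_[m])) -> u =1 w.
Proof.
by move=> uw P; rewrite [P]mpolyE !raddf_sum; apply: eq_bigr => m _; apply: uw.
Qed.

End MonomialFunctional.

Lemma horner_algE_sum (F : nzRingType) (A : algType F) (x : A) (p : {poly F}) :
  horner_alg x p = \sum_(i < size p) p`_i *: x ^+ i.
Proof.
rewrite /horner_alg /horner_morph (@horner_coef_wide _ (size p)) ?size_poly //.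
by apply: eq_bigr => i _; rewrite coef_map mulr_algl.
Qed.

Lemma horner_algE_wide (F : nzRingType) (A : algType F) (x : A) (p : {poly F}) d :
  (size p <= d)%N -> horner_alg x p = \sum_(i < d) p`_i *: x ^+ i.
Proof.
move=> pd; rewrite horner_algE_sum (big_ord_widen d (fun i => p`_i *: x ^+ i)) //.
rewrite big_mkcond; apply: eq_bigr => i _; case: ltnP => // /(nth_default 0) ->.
by rewrite scale0r.
Qed.

Section ProductFunctional.
Context (F : fieldType) (S : comNzRingType) (g : {rmorphism F -> S}) (r : nat).
Context (T : S) (s : 'I_r -> nat -> S).

Local Notation x j := ('X_(lift ord_max j) : {mpoly F[r.+1]}).
Local Notation t := ('X_ord_max : {mpoly F[r.+1]}).

Definition prod_weight (m : 'X_{1..r}) : S := \prod_j s j (m j).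

Definition mnm_lift (m : 'X_{1..r.+1}) : 'X_{1..r} :=
  [multinom m (lift ord_max j) | j < r].

Definition last_weight (m : 'X_{1..r.+1}) : S :=
  T ^+ m ord_max * prod_weight (mnm_lift m).

Local Notation N := (mlin g last_weight).

Lemma last_weight_mulX (j : 'I_r) (m : 'X_{1..r.+1}) k :
  last_weight (m + U_(lift ord_max j) *+ k)%MM
  = T ^+ m ord_max * (s j (m (lift ord_max j) + k)%N
      * \prod_(l | l != j) s l (m (lift ord_max l))).
Proof.
rewrite /last_weight /prod_weight (bigD1 j) //= mnmDE mulmnE mnm1E.
rewrite eq_sym (negPf (neq_lift _ _)) mul0n addn0 mnmE mnmDE mulmnE mnm1E.
rewrite eqxx mul1n; congr (_ * (_ * _)); apply: eq_bigr => l lj.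
rewrite mnmE mnmDE mulmnE mnm1E (inj_eq lift_inj) eq_sym (negPf lj) mul0n.
by rewrite addn0.
Qed.

Lemma mlin_mul_last P k : N (P * t ^+ k) = T ^+ k * N P.
Proof.
rewrite [P]mpolyE mulr_suml !raddf_sum mulr_sumr; apply: eq_bigr => m _.
rewrite -scalerAl mpolyXn -mpolyXD /= !mlinZ !mlinX [RHS]mulrCA; congr (_ * _).
rewrite /last_weight mnmDE mulmnE mnm1E eqxx mul1n exprD mulrA [T ^+ k * _]mulrC.
congr (_ * _); apply: eq_bigr => j _; congr (s j _).
by rewrite !(mnmE, mnmDE, mulmnE, mnm1E) (negPf (neq_lift _ _)) mul0n addn0.
Qed.

Lemma mlin_mul_poly_last P (p : {poly F}) :
  N (P * horner_alg t p) = (map_poly g p).[T] * N P.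
Proof.
rewrite horner_algE_sum mulr_sumr raddf_sum.
rewrite horner_coef size_map_poly mulr_suml; apply: eq_bigr => i _.
by rewrite -scalerAr /= mlinZ mlin_mul_last coef_map mulrA.
Qed.

Lemma mlin_mul_poly_eq0 P (p : {poly F}) (j : 'I_r) :
  (forall a, \sum_(k < size p) g p`_k * s j (a + k)%N = 0) ->
  N (P * horner_alg (x j) p) = 0.
Proof.
move=> rec; rewrite [P]mpolyE mulr_suml raddf_sum big1 // => m _.
rewrite horner_algE_sum -scalerAl [X in _ *: X]mulr_sumr /= mlinZ raddf_sum.
rewrite (eq_bigr (fun i : 'I_(size p) =>
    g p`_i * s j (m (lift ord_max j) + i)%N
    * (T ^+ m ord_max * \prod_(l | l != j) s l (m (lift ord_max l))))).
  by rewrite -mulr_suml rec mul0r mulr0.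
move=> i _; rewrite -scalerAr /= mlinZ mpolyXn -mpolyXD mlinX.
by rewrite last_weight_mulX -mulrA; congr (_ * _); rewrite mulrCA.
Qed.

Lemma mlin_prod n d (p : nat -> {poly F}) :
  (forall k, (size (p k) <= d)%N) ->
  N (\prod_j \sum_(k < n) horner_alg (x j) (p k) * t ^+ k)
  = \prod_j \sum_(k < n) (\sum_(i < d) g (p k)`_i * s j i) * T ^+ k.
Proof.
move=> pd; pose I : finType := ('I_n * 'I_d)%type.
transitivity (N (\prod_j \sum_(u : I)
    (p u.1)`_u.2 *: (x j ^+ u.2 * t ^+ u.1))).
  congr (mlin _ _ _); apply: eq_bigr => j _.
  rewrite -(pair_bigA _ (fun (k : 'I_n) (i : 'I_d) =>
    (p k)`_i *: (x j ^+ i * t ^+ k))) /=; apply: eq_bigr => k _.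
  rewrite (horner_algE_wide _ (pd k)) mulr_suml; apply: eq_bigr => i _.
  by rewrite scalerAl.
transitivity (\prod_j \sum_(u : I) g (p u.1)`_u.2 * s j u.2 * T ^+ u.1); last first.
  apply: eq_bigr => j _.
  rewrite -(pair_bigA _ (fun (k : 'I_n) (i : 'I_d) =>
    g (p k)`_i * s j i * T ^+ k)) /=; apply: eq_bigr => k _.
  by rewrite mulr_suml.
rewrite !bigA_distr_bigA raddf_sum; apply: eq_bigr => u _ /=.
rewrite scaler_prod mlinZ rmorph_prod /= big_split /= [LHS]mulrC.
rewrite [in RHS]big_split /= [in RHS]big_split /= -[RHS]mulrA [RHS]mulrC.
congr (_ * _).
rewrite prodrXr mlin_mul_last prodrXr mulrC; congr (_ * _).
pose m : 'X_{1..r.+1} :=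
  [multinom (if unlift ord_max i is Some j then (u j).2 : nat else 0%N) | i < r.+1].
have mE j : m (lift ord_max j) = (u j).2 by rewrite mnmE liftK.
have m0 : m ord_max = 0%N by rewrite mnmE unlift_none.
have -> : \prod_j x j ^+ (u j).2 = 'X_[m].
  rewrite mpolyXE_id (bigD1_ord ord_max) //= m0 expr0 mul1r.
  by apply: eq_bigr => j _; rewrite mE.
rewrite mlinX /last_weight m0 expr0 mul1r; apply: eq_bigr => j _.
by rewrite mnmE mE.
Qed.

Definition mlift (P : {mpoly F[r]}) : {mpoly F[r.+1]} :=
  mmap (@mpolyC r.+1 F) (fun j => x j) P.

Fact mlift_is_additive : zmod_morphism mlift.
Proof. exact: raddfB. Qed.

Fact mlift_is_multiplicative : monoid_morphism mlift.
Proof. by split; [apply: rmorph1 | apply: rmorphM]. Qed.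

HB.instance Definition _ := GRing.isZmodMorphism.Build
  {mpoly F[r]} {mpoly F[r.+1]} mlift mlift_is_additive.
HB.instance Definition _ := GRing.isMonoidMorphism.Build
  {mpoly F[r]} {mpoly F[r.+1]} mlift mlift_is_multiplicative.

Lemma mliftZ c P : mlift (c *: P) = c *: mlift P.
Proof. by rewrite /mlift mmapZ /= mul_mpolyC. Qed.

Lemma mlift_horner (p : {poly F}) (y : {mpoly F[r]}) :
  mlift (horner_alg y p) = horner_alg (mlift y) p.
Proof.
rewrite !horner_algE_sum raddf_sum; apply: eq_bigr => i _.
by rewrite /= mliftZ rmorphXn.
Qed.

Lemma mliftXU j : mlift 'X_j = x j.
Proof. by rewrite /mlift mmapX mmap1U. Qed.

Lemma mlin_mlift P : N (mlift P) = mlin g prod_weight P.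
Proof.
rewrite [P]mpolyE (raddf_sum mlift) !raddf_sum; apply: eq_bigr => m _ /=.
rewrite mliftZ !mlinZ mlinX; congr (_ * _).
pose m' : 'X_{1..r.+1} :=
  [multinom (if unlift ord_max i is Some j then m j else 0%N) | i < r.+1].
have m'E j : m' (lift ord_max j) = m j by rewrite mnmE liftK.
have m'0 : m' ord_max = 0%N by rewrite mnmE unlift_none.
have -> : mlift 'X_[m] = 'X_[m'].
  rewrite /mlift mmapX /mmap1 mpolyXE_id (bigD1_ord ord_max) //= m'0 expr0 mul1r.
  by apply: eq_bigr => j _; rewrite m'E.
rewrite mlinX /last_weight m'0 expr0 mul1r; apply: eq_bigr => j _.
by rewrite mnmE m'E.
Qed.

End ProductFunctional.

Section WeilOperatorTheory.
Context (F : fieldType) (f : {poly F}).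
Local Notation n := (size f).-1.

Lemma weilD_Xn k : (k < n)%N -> weilD f 'X^k = drop_poly k.+1 f.
Proof.
move=> kn; rewrite /weilD (bigD1 (Ordinal kn)) //= big1 ?addr0; last first.
  move=> i ik; rewrite coefXn -val_eqE in ik *.
  by rewrite (negPf ik) scale0r.
rewrite coefXn eqxx scale1r; apply/polyP => i.
rewrite coef_poly coef_drop_poly addnS addnC.
case: ltnP => // ni; rewrite nth_default //.
by rewrite leq_subLR addnC -ltnS in ni; apply: leq_trans (leqSpred _) ni.
Qed.

Lemma weilO2E (A : comAlgType F) (x y : A) :
  weilO2 f x y = \sum_(k < n) horner_alg x (drop_poly k.+1 f) * y ^+ k.
Proof. by apply: eq_bigr => k _; rewrite weilD_Xn. Qed.

Lemma drop_poly_recl (p : {poly F}) k :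
  drop_poly k p = (p`_k)%:P + drop_poly k.+1 p * 'X.
Proof.
apply/polyP => -[|i]; rewrite coefD coefC coefMX !coef_drop_poly /=.
  by rewrite addr0.
by rewrite add0r addnS addSn.
Qed.

Lemma weilO2_sub (A : comAlgType F) (x y : A) :
  (x - y) * weilO2 f x y = horner_alg x f - horner_alg y f.
Proof.
have telescope d : (x - y) * \sum_(k < d) horner_alg x (drop_poly k.+1 f) * y ^+ k
    = horner_alg x f - horner_alg x (drop_poly d f) * y ^+ d
      - \sum_(k < d) f`_k *: y ^+ k.
  elim: d => [|d IHd].
    by rewrite !big_ord0 drop_poly0l expr0 mulr1 mulr0 subrr subr0.
  rewrite !big_ord_recr /= mulrDr {}IHd (drop_poly_recl f d).
  rewrite rmorphD rmorphM /= horner_algX horner_algC.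
  rewrite (mulrDl _ _ (y ^+ d)) mulr_algl exprS.
  by ring.
rewrite weilO2E telescope (@horner_algE_wide _ _ y f n.+1) ?leqSpred //.
rewrite big_ord_recr /= (drop_poly_recl f) [drop_poly _.+1 f]drop_poly_eq0 ?leqSpred //.
by rewrite mul0r addr0 horner_algC mulr_algl -addrA -opprD [X in - X]addrC.
Qed.

Lemma weilO2_sub_dvd (A : comAlgType F) (z x y : A) :
  exists S, weilO2 f z y - weilO2 f z x = (x - y) * S.
Proof.
exists (- \sum_(k < n) horner_alg z (drop_poly k.+1 f)
  * (\sum_(i < k) y ^+ (k.-1 - i) * x ^+ i)).
rewrite mulrN -mulNr opprB !weilO2E -sumrB mulr_sumr.
by apply: eq_bigr => k _; rewrite mulrCA -mulrBr subrXX.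
Qed.

Lemma prod_sub_dvd (A : comNzRingType) (d : A) (I : Type) (u : seq I) (a b : I -> A) :
  (forall i, exists S, a i - b i = d * S) ->
  exists S, \prod_(i <- u) a i - \prod_(i <- u) b i = d * S.
Proof.
move=> ab; elim/big_rec2: _ => [|i pb pa _ [S abS]].
  by exists 0; rewrite subrr mulr0.
have [S' abS'] := ab i; exists (S' * pb + a i * S).
rewrite mulrDr mulrA -abS' mulrCA -abS; ring.
Qed.

Lemma weilO2_prod_transfer (A : comAlgType F) m (z : 'I_m -> A) (x y : A) :
  exists H1 H2, weilO2 f x y * \prod_j weilO2 f (z j) y
    = weilO2 f x y * \prod_j weilO2 f (z j) x
      + H1 * horner_alg y f + H2 * horner_alg x f.
Proof.
have [S zS] : exists S, \prod_j weilO2 f (z j) y - \prod_j weilO2 f (z j) x = (x - y) * S.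
  by apply: prod_sub_dvd => j; apply: weilO2_sub_dvd.
exists (- S), S; rewrite -[in LHS](subrK (\prod_j weilO2 f (z j) x) (\prod_j _)) zS.
rewrite mulrDr mulrA [weilO2 f x y * (x - y)]mulrC weilO2_sub; ring.
Qed.

Lemma weilO_prod s (O : {mpoly F[s.+1]}) : is_weilO f O ->
  exists H, \prod_(j < s) weilO2 f 'X_(lift ord_max j) 'X_ord_max
    = O + H * horner_alg 'X_ord_max f.
Proof.
case: s O => [|[|s]] O /=.
- by move=> ->; exists 0; rewrite big_ord0 mul0r addr0.
- move=> ->; exists 0; rewrite big_ord1 mul0r addr0.
  by congr (weilO2 _ 'X_ _ _); apply: val_inj.
- by case.
Qed.

Lemma weilO_expand r (O : {mpoly F[r.+1]}) : (0 < r)%N -> is_weilO f O ->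
  exists G : nat -> {mpoly F[r]},
    O = \sum_(k < n) mlift (G k) * 'X_ord_max ^+ k.
Proof.
case: r O => [//|[|r]] O _.
  move=> /= ->; exists (fun k => horner_alg 'X_ord0 (drop_poly k.+1 f)).
  rewrite weilO2E; apply: eq_bigr => k _.
  rewrite mlift_horner mliftXU.
  by have -> : lift ord_max ord0 = ord0 :> 'I_2 by apply: val_inj.
move=> [deg _].
pose G k := \sum_(m <- msupp O | m ord_max == k) O@_m *: 'X_[mnm_lift m].
exists G.
have GE (m : 'X_{1..r.+3}) : mlift ('X_[mnm_lift m] : {mpoly F[_]})
    * 'X_ord_max ^+ m ord_max = 'X_[m].
  rewrite /mlift mmapX /mmap1 [RHS]mpolyXE_id.
  rewrite [RHS](bigD1_ord ord_max) //= mulrC.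
  by congr (_ * _); apply: eq_bigr => j _; rewrite mnmE.
rewrite {1}[O]mpolyE.
rewrite (eq_bigr (fun k : 'I_n => \sum_(m <- msupp O | m ord_max == k) O@_m *: 'X_[m])).
  rewrite (exchange_big_dep xpredT) //= !big_seq; apply: eq_bigr => m mO.
  by rewrite (big_pred1 (Ordinal (deg m mO ord_max))).
move=> k _; rewrite raddf_sum mulr_suml; apply: eq_bigr => m /eqP <-.
by rewrite /= mliftZ -scalerAl GE.
Qed.

End WeilOperatorTheory.

Section WeilFunctional.
Context (F : fieldType) (S : comNzRingType) (g : {rmorphism F -> S}).
Context (f : {poly F}).
Local Notation n := (size f).-1.

Definition dual_coef (s : nat -> S) k : S :=
  \sum_(i < size f) g (drop_poly k.+1 f)`_i * s i.

Lemma mlin_weilO_prod r (O : {mpoly F[r.+1]}) : is_weilO f O ->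
  exists H : {mpoly F[r.+1]}, forall T (s : 'I_r -> nat -> S),
    \prod_j \sum_(k < n) dual_coef (s j) k * T ^+ k
    = mlin g (last_weight T s) O
      + (map_poly g f).[T] * mlin g (last_weight T s) H.
Proof.
move=> /weilO_prod [H OE]; exists H => T s.
rewrite -mlin_mul_poly_last -raddfD -OE.
rewrite -(@mlin_prod _ _ g r T s n (size f) (fun k => drop_poly k.+1 f)); last first.
  by move=> k; rewrite size_drop_poly leq_subr.
by congr (mlin _ _ _); apply: eq_bigr => j _; rewrite weilO2E.
Qed.

Lemma mlin_weilO_expand r (O : {mpoly F[r.+1]}) : (0 < r)%N -> is_weilO f O ->
  exists G : nat -> {mpoly F[r]}, forall T (s : 'I_r -> nat -> S),
    mlin g (last_weight T s) O
    = \sum_(k < n) T ^+ k * mlin g (prod_weight s) (G k).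
Proof.
move=> r0 /(weilO_expand r0) [G ->]; exists G => T s.
rewrite raddf_sum; apply: eq_bigr => k _.
by rewrite /= mlin_mul_last mlin_mlift.
Qed.

Lemma mlin_weilO_last r (O : {mpoly F[r.+1]}) (O1 : {mpoly F[r.+2]}) :
  is_weilO f O -> is_weilO f O1 ->
  exists H : {mpoly F[r.+2]}, forall T (s : 'I_r.+1 -> nat -> S),
    (forall j a, \sum_(k < size f) g f`_k * s j (a + k)%N = 0) ->
    mlin g (last_weight T s) O1
    = \sum_(k < n) T ^+ k * mlin g (prod_weight s)
                     (horner_alg 'X_ord_max (drop_poly k.+1 f) * O)
      + (map_poly g f).[T] * mlin g (last_weight T s) H.
Proof.
move=> /weilO_prod [H OE] /weilO_prod [H' O1E].
set t : {mpoly F[r.+2]} := 'X_ord_max in O1E.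
pose x j : {mpoly F[r.+2]} := 'X_(lift ord_max j).
have [H1 [H2 transfer]] :=
  weilO2_prod_transfer f (fun j => x (lift ord_max j)) (x ord_max) t.
have {}OE : \prod_(j < r) weilO2 f (x (lift ord_max j)) (x ord_max)
    = mlift O + mlift H * horner_alg (x ord_max) f.
  rewrite /x -!mliftXU -mlift_horner -rmorphM -rmorphD -OE rmorph_prod.
  apply: eq_bigr => j _; rewrite !weilO2E rmorph_sum; apply: eq_bigr => k _.
  by rewrite rmorphM rmorphXn /= mlift_horner !mliftXU.
exists (H1 - H') => T s rec.
have {}O1E : O1 = weilO2 f (x ord_max) t * mlift O
    + (weilO2 f (x ord_max) t * mlift H + H2) * horner_alg (x ord_max) f
    + (H1 - H') * horner_alg t f.
  apply: (addIr (H' * horner_alg t f)); rewrite -O1E.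
  rewrite (bigD1_ord ord_max) //= -/(x _) transfer OE; ring.
rewrite O1E 2!raddfD /= mlin_mul_poly_last (mlin_mul_poly_eq0 _ _ (rec ord_max)).
rewrite addr0; congr (_ + _); rewrite weilO2E mulr_suml raddf_sum.
apply: eq_bigr => k _; rewrite /= mulrAC mlin_mul_last.
by rewrite -(mlin_mlift _ T) rmorphM /= mlift_horner mliftXU.
Qed.

End WeilFunctional.

Section Frobenius.
Context (R : realType) (F : finFieldType) (Ci : cinfty R F).
Local Notation q := #|F|.
Local Notation iota := (cinf_iota Ci).

Lemma q_gt0 k : (0 < q ^ k)%N.
Proof. by rewrite expn_gt0 (ltnW (card_finNzRing_gt1 F)). Qed.

Definition frob k (x : Ci) : Ci := x ^+ (q ^ k).

Fact frob_is_additive k : zmod_morphism (frob k).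
Proof.
move=> a b; rewrite /frob -[in LHS]mulN1r -(rmorphN1 iota) addrC.
by rewrite frobenius_linear rmorphN1 mulN1r addrC.
Qed.

Fact frob_is_multiplicative k : monoid_morphism (frob k).
Proof. by split=> [|a b]; rewrite /frob ?expr1n ?exprMn. Qed.

HB.instance Definition _ k :=
  GRing.isZmodMorphism.Build Ci Ci (frob k) (frob_is_additive k).
HB.instance Definition _ k :=
  GRing.isMonoidMorphism.Build Ci Ci (frob k) (frob_is_multiplicative k).

Lemma frob_iota k c : frob k (iota c) = iota c.
Proof.
have := frobenius_linear k c 1 (0 : Ci).
by rewrite !mulr1 addr0 expr1n expr0n (gtn_eqF (q_gt0 k)) mulr1 addr0.
Qed.

Lemma map_frob_iota k (p : {poly F}) :
  map_poly (frob k) (map_poly iota p) = map_poly iota p.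
Proof. by apply/polyP => i; rewrite !coef_map /= frob_iota. Qed.

End Frobenius.

Section TateEvaluation.
Context (R : realType) (C : fieldType) (v : nonarch R C).

Fact tate_of_poly_null (p : {poly C}) : vnull v (fun i => p`_i).
Proof.
by apply/vnullP => e e0; exists (size p) => i pi; rewrite nth_default // nabs0.
Qed.

Definition tate_of_poly (p : {poly C}) : tate v := Tate (tate_of_poly_null p).

Lemma tcoefD (a b : tate v) k : tcoef (a + b) k = tcoef a k + tcoef b k.
Proof. by []. Qed.

Lemma tcoef_sum (I : Type) (s : seq I) (a : I -> tate v) k :
  tcoef (\sum_(i <- s) a i) k = \sum_(i <- s) tcoef (a i) k.
Proof. by elim/big_rec2: _ => //= i x y _ <-. Qed.

Lemma tcoef_mulC c (a : tate v) k :
  tcoef (tate_of_poly c%:P * a) k = c * tcoef a k.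
Proof.
rewrite /= big_ord_recl /= coefC subn0 big1 ?addr0 // => i _.
by rewrite coefC mul0r.
Qed.

Lemma tcoef_mulX (a : tate v) k :
  tcoef (tate_of_poly 'X * a) k = if k is k'.+1 then tcoef a k' else 0.
Proof.
case: k => [|k] /=; first by rewrite big_ord_recl big_ord0 coefX mul0r addr0.
rewrite big_ord_recl coefX mul0r add0r big_ord_recl coefX mul1r big1 ?addr0.
  by rewrite subSS subn0.
by move=> i _; rewrite coefX mul0r.
Qed.

End TateEvaluation.

Section EvaluationTwist.
Context (R : realType) (F : finFieldType) (Ci : cinfty R F).
Local Notation q := #|F|.
Local Notation iota := (cinf_iota Ci).
Local Notation v := (cinf_abs Ci).
Context (n : nat) (n_gt0 : (0 < n)%N).
Context (f : {poly F}) (f_monic : f \is monic) (f_deg : size f = n.+1).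
Local Notation fC := (map_poly iota f).
Context (ev : {rmorphism tate v -> {poly %/ fC}}) (ev_f : is_evaluation ev).

Lemma fC_monic : fC \is monic.
Proof. by rewrite map_monic. Qed.

Lemma size_fC : size fC = n.+1.
Proof. by rewrite size_map_poly. Qed.

Lemma mk_monic_fC : mk_monic fC = fC.
Proof. by rewrite /mk_monic size_fC ltnS n_gt0 fC_monic. Qed.

Lemma size_qpoly (p : {poly %/ fC}) : (size (p : {poly Ci}) <= n)%N.
Proof.
have size_mk : size (mk_monic fC) = n.+1 by rewrite mk_monic_fC size_fC.
by rewrite -ltnS -size_mk size_mk_monic.
Qed.

Lemma in_qpolyE (p : {poly Ci}) : in_qpoly fC p = p %% fC :> {poly Ci}.
Proof. by rewrite /= mk_monic_fC Pdiv.IdomainMonic.modpE // fC_monic. Qed.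

Lemma in_qpoly_id (p : {poly Ci}) : (size p <= n)%N -> in_qpoly fC p = p :> {poly Ci}.
Proof. by move=> pn; rewrite in_qpolyE modp_small // size_fC. Qed.

Lemma in_qpolyK (p : {poly %/ fC}) : in_qpoly fC p = p.
Proof.
apply: val_inj; transitivity (in_qpoly fC p : {poly Ci}) => //.
by rewrite in_qpoly_id ?size_qpoly.
Qed.

Lemma ev_twist_coef k (w : tate v) j :
  (ev (twist F k w) : {poly Ci})`_j = (ev w : {poly Ci})`_j ^+ (q ^ k).
Proof.
apply/eqP; rewrite -subr_eq0 -(nabs_eq0 v) eq_le nabs_ge0 andbT.
apply/ler_addgt0Pr => eps eps0; rewrite add0r.
have frob_le (x y : Ci) (d : R) : v (x - y) <= d -> d <= 1 ->
    v (x ^+ (q ^ k) - y ^+ (q ^ k)) <= d.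
  move=> xyd d1; rewrite -[_ - _](rmorphB (frob k)) /frob nabsX.
  rewrite -(prednK (q_gt0 F k)) exprS; apply: le_trans (xyd).
  rewrite ler_piMr ?nabs_ge0 // exprn_ile1 ?nabs_ge0 //.
  exact: le_trans xyd d1.
pose eps1 := Num.min eps 1.
have eps1_gt0 : 0 < eps1 by rewrite lt_min eps0 ltr01.
have [d1 d1_gt0 near_w] := ev_continuous ev_f w eps1_gt0.
have [d2 d2_gt0 near_tw] := ev_continuous ev_f (twist F k w) eps0.
pose d := Num.min (Num.min d1 d2) 1.
have d_gt0 : 0 < d by rewrite !lt_min d1_gt0 d2_gt0 ltr01.
have /vnullP /(_ d d_gt0) [N small] := tcoef_null w.
pose p := \poly_(i < N) tcoef w i.
have p_near i : v (p`_i - tcoef w i) <= d.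
  rewrite coef_poly; case: ltnP => [_|/small /ltW].
    by rewrite subrr nabs0 ltW.
  by rewrite sub0r nabsN.
have [dd1 dd2 d_le1] : [/\ d <= d1, d <= d2 & d <= 1].
  by rewrite !ge_min !lexx !orbT.
have evp : ev (tate_of_poly v p) = in_qpoly fC p by exact: (ev_poly ev_f).
have evtp : ev (twist F k (tate_of_poly v p)) = in_qpoly fC (map_poly (frob k) p).
  by apply: (ev_poly ev_f) => i; rewrite coef_map.
have evpk : (ev (twist F k (tate_of_poly v p)) : {poly Ci})`_j
    = (ev (tate_of_poly v p) : {poly Ci})`_j ^+ (q ^ k).
  rewrite evtp evp !in_qpolyE -{1}(map_frob_iota Ci k f) -map_modp.
  by rewrite coef_map.
have le1 : v ((ev (twist F k (tate_of_poly v p)) : {poly Ci})`_j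
    - (ev (twist F k w) : {poly Ci})`_j) <= eps.
  apply: near_tw => i; apply: le_trans dd2.
  exact: (frob_le _ _ _ (p_near i) d_le1).
have le2 : v ((ev (tate_of_poly v p) : {poly Ci})`_j ^+ (q ^ k)
    - (ev w : {poly Ci})`_j ^+ (q ^ k)) <= eps.
  apply: (@le_trans _ _ eps1); last by rewrite ge_min lexx.
  apply: frob_le; last by rewrite ge_min lexx orbT.
  by apply: near_w => i; apply: le_trans (p_near i) dd1.
rewrite evpk in le1.
rewrite -[X in v X](subrKA ((ev (tate_of_poly v p) : {poly Ci})`_j ^+ (q ^ k))).
apply: (le_trans (nabsD v _ _)); rewrite ge_max le2 andbT.
by rewrite -nabsN opprB.
Qed.

Lemma ev_twist k (w : tate v) :
  ev (twist F k w) = in_qpoly fC (map_poly (frob k) (ev w : {poly Ci})).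
Proof.
apply: val_inj; set p := map_poly (frob k) _.
transitivity (in_qpoly fC p : {poly Ci}) => //; rewrite in_qpoly_id.
  by apply/polyP => j; rewrite ev_twist_coef coef_map.
by rewrite size_map_poly size_qpoly.
Qed.

End EvaluationTwist.

Section DrinfeldAction.
Context (R : realType) (F : finFieldType) (Ci : cinfty R F).
Local Notation q := #|F|.
Local Notation iota := (cinf_iota Ci).
Local Notation theta := (cinf_theta Ci).
Local Notation v := (cinf_abs Ci).
Context (K : divringClosed Ci) (r : nat) (phi : drinfeld K r).
Local Notation phi_x := (phi_x phi).

Lemma phi_x_linear c a b : phi_x (iota c * a + b) = iota c * phi_x a + phi_x b.
Proof.
rewrite /Defs.phi_x (eq_bigr (fun i => iota c * (dri_coef phi i * a ^+ (q ^ i))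
    + dri_coef phi i * b ^+ (q ^ i))).
  by rewrite big_split /= -mulr_sumr mulrDr; ring.
by move=> i _; rewrite frobenius_linear; ring.
Qed.

Lemma phi_x0 : phi_x 0 = 0.
Proof. by have := phi_x_linear (-1) 0 0; rewrite mulr0 addr0 rmorphN1 mulN1r addNr. Qed.

Lemma phi_x_sum (I : Type) (s : seq I) (c : I -> F) (u : I -> Ci) :
  phi_x (\sum_(i <- s) iota (c i) * u i) = \sum_(i <- s) iota (c i) * phi_x (u i).
Proof.
by elim/big_rec2: _ => [|i x y _ <-]; [apply: phi_x0 | apply: phi_x_linear].
Qed.

Lemma iter_phi_x_sum (I : Type) (s : seq I) (c : I -> F) (u : I -> Ci) k :
  iter k phi_x (\sum_(i <- s) iota (c i) * u i)
  = \sum_(i <- s) iota (c i) * iter k phi_x (u i).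
Proof. by elim: k => //= k ->; apply: phi_x_sum. Qed.

Lemma phi_act_Xn k mu : phi_act phi 'X^k mu = iter k phi_x mu.
Proof.
rewrite /phi_act size_polyXn big_ord_recr /= coefXn eqxx rmorph1 mul1r.
by rewrite big1 ?add0r // => i _; rewrite coefXn ltn_eqF // rmorph0 mul0r.
Qed.

Context (e : exponential phi).

Lemma exp_theta mu : phi_x (e mu) = e (theta * mu).
Proof.
have := exp_functional e 'X^1 mu; rewrite phi_act_Xn /= => ->.
by rewrite expr1 map_polyX hornerX.
Qed.

Lemma theta_neq0 : theta != 0.
Proof.
rewrite -(nabs_eq0 v) cinf_abs_theta pnatr_eq0 -lt0n ltnW //.
exact: card_finNzRing_gt1.
Qed.

Lemma anderson_relation z : in_lattice e z ->
  tate_of_poly v theta%:P * anderson e z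
    + \sum_(1 <= i < r.+1) tate_of_poly v (dri_coef phi i)%:P
        * twist F i (anderson e z)
  = tate_of_poly v 'X * anderson e z.
Proof.
move=> ez0; apply: tateP => k; rewrite tcoefD tcoef_sum tcoef_mulX tcoef_mulC.
under eq_bigr do rewrite tcoef_mulC.
rewrite -[LHS]/(phi_x (e (z / theta ^+ k.+1))) exp_theta exprS invfM.
rewrite mulrCA mulVKf ?theta_neq0 //; case: k => [|k] //=.
by rewrite expr0 invr1 mulr1.
Qed.

Context (n : nat) (n_gt0 : (0 < n)%N).
Context (f : {poly F}) (f_monic : f \is monic) (f_deg : size f = n.+1).
Local Notation fC := (map_poly iota f).
Context (ev : {rmorphism tate v -> {poly %/ fC}}) (ev_f : is_evaluation ev).
Context (z : Ci) (z_lattice : in_lattice e z).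

Local Notation c := (ev (anderson e z) : {poly Ci}).

Lemma remainder_relation j :
  phi_x c`_j = ('X * c)`_j - c`_n.-1 * iota f`_j.
Proof.
have size_c : (size c <= n)%N by apply: size_qpoly.
have evE (a : {poly Ci}) : ev (tate_of_poly v a) = in_qpoly fC a.
  exact: (ev_poly ev_f).
pose p := \poly_(j < n) phi_x c`_j.
have pE i : p`_i = phi_x c`_i.
  rewrite coef_poly; case: ltnP => // ni.
  by rewrite nth_default ?phi_x0 // (leq_trans size_c).
have rel : in_qpoly fC p = in_qpoly fC ('X * c - c`_n.-1 *: fC).
  have := congr1 ev (anderson_relation z_lattice).
  rewrite rmorphD rmorph_sum !rmorphM /= !evE.
  under eq_bigr do rewrite rmorphM /= evE (ev_twist n_gt0 f_monic f_deg ev_f) -rmorphM /=.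
  rewrite -[X in _ * X + _ = _](in_qpolyK n_gt0 f_monic f_deg).
  rewrite -[X in _ = _ * X](in_qpolyK n_gt0 f_monic f_deg) -!rmorphM -rmorph_sum -rmorphD /=.
  have -> : theta%:P * c + \sum_(1 <= i < r.+1) (dri_coef phi i)%:P
      * map_poly (frob i) c = p.
    apply/polyP => i; rewrite pE coefD coefCM coef_sum; congr (_ + _).
    by apply: eq_bigr => l _; rewrite coefCM coef_map.
  move=> ->; rewrite rmorphB /= rmorphM.
  suff -> : in_qpoly fC (c`_n.-1 *: fC) = 0 by rewrite subr0.
  by apply: val_inj; rewrite -[LHS]/(in_qpoly fC _ : {poly Ci})
    (in_qpolyE n_gt0 f_monic f_deg) modpZl modpp scaler0.
have := congr1 (fun a : {poly %/ fC} => (a : {poly Ci})`_j) rel.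
rewrite !(in_qpoly_id n_gt0 f_monic f_deg) ?size_poly //; last first.
  apply/leq_sizeP => i; rewrite leq_eqVlt coefB coefXM coefZ coef_map /=.
  case/predU1P=> [<-|ni]; first rewrite gtn_eqF //.
    have := f_monic; rewrite monicE lead_coefE f_deg /= => /eqP->.
    by rewrite rmorph1 mulr1 subrr.
  rewrite gtn_eqF ?(leq_trans _ ni) // [f`_i]nth_default ?f_deg //.
  rewrite rmorph0 mulr0 subr0 nth_default //.
  by rewrite (leq_trans size_c) // -ltnS prednK ?(leq_trans _ ni).
by rewrite pE coefB coefZ coef_map.
Qed.

Lemma remainder_coef k :
  c`_k = \sum_(i < size f) iota (drop_poly k.+1 f)`_i * iter i phi_x c`_n.-1.
Proof.
have [d] := ubnP (n - k); elim: d k => // d IHd k; rewrite ltnS => nkd.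
have [nk|kn] := leqP n k.
  rewrite nth_default ?(leq_trans (size_qpoly n_gt0 f_monic f_deg _)) //.
  rewrite drop_poly_eq0 ?f_deg // big1 // => i _.
  by rewrite coef0 rmorph0 mul0r.
have := remainder_relation k.+1; rewrite coefXM /= => /eqP.
rewrite eq_sym subr_eq => /eqP ->; rewrite IHd; last first.
  by rewrite subnS prednK ?subn_gt0 // (leq_trans _ nkd).
rewrite phi_x_sum f_deg big_ord_recr [RHS]big_ord_recl /= !coef_drop_poly.
have -> : f`_(n + k.+2) = 0 by rewrite nth_default // f_deg addnS ltnS leq_addr.
rewrite rmorph0 mul0r addr0 addrC mulrC.
by congr (_ + _); apply: eq_bigr => i _; rewrite !coef_drop_poly addnS.
Qed.

Lemma remainder_lead_torsion :
  \sum_(i < size f) iota f`_i * iter i phi_x c`_n.-1 = 0.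
Proof.
have := remainder_relation 0; rewrite coefXM /= sub0r remainder_coef.
rewrite phi_x_sum f_deg big_ord_recr [in X in _ -> X]big_ord_recl /= coef_drop_poly.
rewrite [f`_(n + _)]nth_default ?f_deg ?addn1 // rmorph0 mul0r addr0 mulrC => E.
rewrite (eq_bigr (fun i : 'I_n => iota (drop_poly 1 f)`_i * phi_x (iter i phi_x c`_n.-1))).
  by rewrite E subrr.
by move=> i _; rewrite coef_drop_poly addn1.
Qed.

End DrinfeldAction.

Section MooreDiamond.
Context (R : realType) (F : finFieldType) (Ci : cinfty R F).
Local Notation iota := (cinf_iota Ci).
Context (K : divringClosed Ci) (r : nat) (phi : drinfeld K r).
Context (mu : 'I_r -> Ci).

Local Notation gC := (polyC \o iota).

Definition moore_det (m : 'X_{1..r}) : Ci :=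
  \det (\matrix_(i < r, j < r) frob i (iter (m j) (phi_x phi) (mu j))).

Definition moore_const (P : {mpoly F[r]}) : Ci := mlin iota moore_det P.

Definition orbit_coef (s : 'S_r) (j : 'I_r) (a : nat) : {poly Ci} :=
  (frob (s j) (iter a (phi_x phi) (mu j)))%:P.

Lemma moore_detE m :
  (moore_det m)%:P = \sum_(s : 'S_r) (-1) ^+ s * prod_weight (orbit_coef s) m.
Proof.
rewrite /moore_det -det_tr /determinant rmorph_sum; apply: eq_bigr => s _.
rewrite /= rmorphM rmorph_sign rmorph_prod; congr (_ * _).
by apply: eq_bigr => j _; rewrite !mxE.
Qed.

Lemma moore_constE P :
  (moore_const P)%:P
  = \sum_(s : 'S_r) (-1) ^+ s * mlin gC (prod_weight (orbit_coef s)) P.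
Proof.
rewrite -(mlin_sum gC P moore_detE) /moore_const /mlin rmorph_sum.
by apply: eq_bigr => m _; rewrite /= rmorphM.
Qed.

Lemma moore_diamondE (G : {mpoly {poly F}[r]}) :
  moore (diamond phi G mu) = mlin (map_poly iota) (fun m => (moore_det m)%:P) G.
Proof.
rewrite /moore /diamond big_map; apply: eq_bigr => m _ /=.
congr (_ * (\det _)%:P); apply/matrixP => i j; rewrite !mxE.
by rewrite phi_act_Xn.
Qed.

Lemma moore_diamond_const (P : {mpoly F[r]}) :
  moore (diamond phi (const_t P) mu) = (moore_const P)%:P.
Proof.
rewrite moore_diamondE /const_t /moore_const; move: P.
apply: (mpoly_additive_eq (u := mlin _ _ \o map_mpoly polyC)
  (w := polyC \o mlin _ _)) => c m /=.
by rewrite map_mpolyZ map_mpolyX !mlinZ !mlinX /= map_polyC polyCM.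
Qed.

Lemma moore_diamond_last (P : {mpoly F[r.+1]}) :
  moore (diamond phi (last_t P) mu)
  = \sum_(s : 'S_r) (-1) ^+ s * mlin gC (last_weight 'X (orbit_coef s)) P.
Proof.
pose h (m : 'X_{1..r.+1}) := 'X^(m ord_max) * (moore_det (mnm_lift m))%:P.
rewrite -(@mlin_sum _ _ _ gC h) => [|m]; last first.
  rewrite /h moore_detE mulr_sumr; apply: eq_bigr => s _.
  by rewrite mulrCA.
rewrite moore_diamondE.
pose x i : {mpoly {poly F}[r]} :=
  if unlift ord_max i is Some j then 'X_j else 'X%:MP.
rewrite -[last_t P]/(mmap (@mpolyC r {poly F} \o polyC) x P).
move: P; apply: (mpoly_additive_eq
  (u := mlin _ _ \o mmap (@mpolyC r {poly F} \o polyC) x) (w := mlin _ _)) => c m /=.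
have -> : mmap (@mpolyC r {poly F} \o polyC) x (c *: 'X_[m])
    = (c%:P * 'X^(m ord_max)) *: 'X_[mnm_lift m].
  rewrite mmapZ mmapX /= /mmap1 (bigD1_ord ord_max) //= /x unlift_none.
  rewrite -mul_mpolyC mpolyCM mulrA -rmorphXn mpolyXE_id; congr (_ * _).
  by apply: eq_bigr => j _; rewrite liftK mnmE.
by rewrite !mlinZ !mlinX rmorphM /= map_polyC map_polyXn mulrA.
Qed.

End MooreDiamond.

Section WeilPairing.
Context (R : realType) (F : finFieldType) (Ci : cinfty R F).
Local Notation iota := (cinf_iota Ci).
Local Notation v := (cinf_abs Ci).
Local Notation gC := (polyC \o iota).
Context (K : divringClosed Ci) (r : nat) (phi : drinfeld K r.+1).
Context (e : exponential phi) (n : nat) (n_gt0 : (0 < n)%N).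
Context (f : {poly F}) (f_monic : f \is monic) (f_deg : size f = n.+1).
Local Notation fC := (map_poly iota f).
Context (ev : {rmorphism tate v -> {poly %/ fC}}) (ev_f : is_evaluation ev).
Context (O : {mpoly F[r.+1]}) (O_def : is_weilO f O).
Context (O1 : {mpoly F[r.+2]}) (O1_def : is_weilO f O1).
Context (z : 'I_r.+1 -> Ci) (z_lattice : forall i, in_lattice e (z i)).

Local Notation c j := (ev (anderson e (z j)) : {poly Ci}).
Local Notation Cz := (fun j => (c j)`_n.-1).
Local Notation moore_last := (moore (diamond phi (last_t O1) Cz)).

Lemma map_gC_hornerX : (map_poly gC f).['X] = fC.
Proof. by rewrite map_poly_comp -[LHS]/(fC \Po 'X) comp_polyXr. Qed.

Lemma size_moore_last : (size moore_last <= n)%N.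
Proof.
have [G GE] := mlin_weilO_expand gC (ltn0Sn r) O1_def.
have -> : moore_last = \poly_(k < n) moore_const phi Cz (G k).
  rewrite moore_diamond_last poly_def; under eq_bigr do rewrite GE f_deg mulr_sumr.
  rewrite exchange_big; apply: eq_bigr => k _ /=.
  rewrite -mul_polyC moore_constE mulr_suml; apply: eq_bigr => s _.
  by rewrite mulrCA mulrC.
exact: size_poly.
Qed.

Lemma moore_last_mod : exists W, moore_last =
  \poly_(k < n) moore_const phi Cz (horner_alg 'X_ord_max (drop_poly k.+1 f) * O)
  + W * fC.
Proof.
have [H HE] := mlin_weilO_last gC O_def O1_def.
exists (\sum_(s : 'S_r.+1) (-1) ^+ s
  * mlin gC (last_weight 'X (orbit_coef phi Cz s)) H).
rewrite moore_diamond_last poly_def mulr_suml.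
rewrite [X in _ = X + _](eq_bigr (fun k : 'I_n => \sum_(s : 'S_r.+1) (-1) ^+ s
  * ('X^k * mlin gC (prod_weight (orbit_coef phi Cz s))
       (horner_alg 'X_ord_max (drop_poly k.+1 f) * O)))); last first.
  move=> k _; rewrite -mul_polyC moore_constE mulr_suml; apply: eq_bigr => s _.
  by rewrite [in RHS]mulrCA mulrC.
rewrite exchange_big -big_split; apply: eq_bigr => s _ /=.
rewrite -mulr_sumr -mulrA -mulrDr; congr (_ * _).
rewrite HE ?f_deg ?map_gC_hornerX; first by rewrite [fC * _]mulrC.
move=> j a.
have := remainder_lead_torsion n_gt0 f_monic f_deg ev_f (z_lattice j).
move/(congr1 (fun x => (frob (s j) (iter a (phi_x phi) x))%:P : {poly Ci})).
rewrite iter_phi_x_sum rmorph_sum rmorph_sum /=.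
have -> : iter a (phi_x phi) 0 = 0 by elim: a => //= a ->; apply: phi_x0.
rewrite rmorph0 polyC0 f_deg => torsion; rewrite -[RHS]torsion.
apply: eq_bigr => k _.
by rewrite /orbit_coef rmorphM /= frob_iota polyCM iterD.
Qed.

Lemma moore_last_lead : (moore_last`_n.-1)%:P = weil_pairing phi O Cz.
Proof.
have [W moore_lastE] := moore_last_mod; set p := \poly_(k < n) _ in moore_lastE.
have -> : moore_last = p.
  have small (a : {poly Ci}) : (size a <= n)%N -> a %% fC = a.
    by move=> an; rewrite modp_small // size_map_poly f_deg.
  rewrite -(small _ size_moore_last) moore_lastE modpD modp_mull addr0 small //.
  exact: size_poly.
rewrite /weil_pairing moore_diamond_const coef_poly prednK // leqnn.
rewrite drop_poly_recl [drop_poly n.+1 f]drop_poly_eq0 ?f_deg // mul0r addr0.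
have := f_monic; rewrite monicE lead_coefE f_deg /= => /eqP->.
by rewrite rmorph1 mul1r.
Qed.

Lemma ev_moore :
  ev (\det (\matrix_(i < r.+1, j < r.+1) twist F i (anderson e (z j))))
  = moore_last :> {poly Ci}.
Proof.
pose G : 'M[{poly Ci}]_r.+1 := \matrix_(i, j) map_poly (frob i) (c j).
have [H HE] := mlin_weilO_prod gC O1_def.
have detG : \det G = moore_last + fC * \sum_(s : 'S_r.+1) (-1) ^+ s
    * mlin gC (last_weight 'X (orbit_coef phi Cz s)) H.
  rewrite moore_diamond_last mulr_sumr -big_split -det_tr /=.
  apply: eq_bigr => s _; rewrite mulrCA -mulrDr; congr (_ * _).
  have /esym := HE 'X (orbit_coef phi Cz s); rewrite map_gC_hornerX => ->.
  apply: eq_bigr => j _; rewrite !mxE f_deg /=.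
  transitivity (\poly_(k < n) frob (s j) (c j)`_k).
    apply/polyP => k; rewrite coef_map coef_poly /=; case: ltnP => // nk.
    rewrite nth_default ?rmorph0 //.
    exact: leq_trans (size_qpoly n_gt0 f_monic f_deg _) nk.
  rewrite poly_def; apply: eq_bigr => k _; rewrite -mul_polyC; congr (_ * _).
  rewrite (remainder_coef n_gt0 f_monic f_deg ev_f (z_lattice j)) /dual_coef.
  rewrite !rmorph_sum; apply: eq_bigr => i _.
  by rewrite /orbit_coef /= rmorphM /= frob_iota polyCM.
rewrite -det_map_mx.
have -> : map_mx ev (\matrix_(i < r.+1, j < r.+1) twist F i (anderson e (z j)))
    = map_mx (in_qpoly fC) G.
  apply/matrixP => i j; rewrite !mxE.
  exact: (ev_twist n_gt0 f_monic f_deg ev_f).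
rewrite det_map_mx detG (in_qpolyE n_gt0 f_monic f_deg) modpD modp_mulr addr0.
by rewrite modp_small // size_map_poly f_deg ltnS size_moore_last.
Qed.

Lemma weil_moore :
  let kappa : tate v :=
    \det (\matrix_(i < r.+1, j < r.+1) twist F i (anderson e (z j))) in
  let Kc (j : nat) : Ci := (ev kappa : {poly Ci})`_j in
  \sum_(j < n) Kc j *: 'X^j = moore_last
  /\ (Kc n.-1)%:P = weil_pairing phi O Cz.
Proof.
move=> kappa Kc; rewrite {}/Kc ev_moore moore_last_lead; split=> //.
rewrite -poly_def; apply/polyP => j; rewrite coef_poly; case: ltnP => // nj.
by rewrite nth_default // (leq_trans size_moore_last).
Qed.

End WeilPairing.

Theorem theorem5p5 (R : realType) (F : finFieldType) (Ci : cinfty R F)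
  (K : divringClosed Ci)
  (K_const : forall c : F, cinf_iota Ci c \in K)
  (K_theta : cinf_theta Ci \in K)
  (r : nat) (r_gt0 : (0 < r)%N)
  (phi : drinfeld K r) (e : exponential phi)
  (n : nat) (n_gt0 : (0 < n)%N)
  (f : {poly F}) (f_monic : f \is monic) (f_deg : size f = n.+1)
  (ev : {rmorphism tate (cinf_abs Ci) -> {poly %/ map_poly (cinf_iota Ci) f}})
  (ev_f : is_evaluation ev)
  (Or : {mpoly F[r]}) (Or_def : is_weilO f Or)
  (Or1 : {mpoly F[r.+1]}) (Or1_def : is_weilO f Or1)
  (z : 'I_r -> Ci) (z_lattice : forall i, in_lattice e (z i)) :
  let kappa : tate (cinf_abs Ci) :=
    \det (\matrix_(i < r, j < r) twist F i (anderson e (z j))) in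
  let Kc (j : nat) : Ci := (ev kappa : {poly Ci})`_j in
  let Cz (i : 'I_r) : Ci := (ev (anderson e (z i)) : {poly Ci})`_n.-1 in
  \sum_(j < n) Kc j *: 'X^j = moore (diamond phi (last_t Or1) Cz)
  /\ (Kc n.-1)%:P = weil_pairing phi Or Cz.
Proof.
case: r r_gt0 phi e Or Or_def Or1 Or1_def z z_lattice => [//|r] _ phi e.
move=> Or Or_def Or1 Or1_def z z_lattice.
exact: (weil_moore n_gt0 f_monic f_deg ev_f Or_def Or1_def z_lattice).
Qed.
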